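(* Let $\mathsf V=(\mathsf V,\otimes,\mathsf k)$ and $\mathsf W=(\mathsf W,\otimes,\mathsf l)$ be completely distributive and integral quantales, let $\varphi:\mathsf V\to\mathsf W$ be a monotone map and $\psi:\mathsf W\to\mathsf V$ a lax homomorphism of quantales. Then the following statements are equivalent: (i) $\varphi\dashv\psi:\mathsf W\to\mathsf V$ (i.e. $\varphi$ is left adjoint to $\psi$ as monotone maps); (ii) $\overline B_\varphi\dashv B_\psi:(\beta,\mathsf W)\text{-}\mathbf{Alg}\to(\beta,\mathsf V)\text{-}\mathbf{Alg}$ (i.e. $B_\psi$ maps $(\beta,\mathsf W)\text{-}\mathbf{Alg}$ into $(\beta,\mathsf V)\text{-}\mathbf{Alg}$ and has $\overline B_\varphi$ as left adjoint); (iii) $\overline B_\varphi\dashv B_\psi:\mathsf W\text{-}\mathbf{Cat}\to\mathsf V\text{-}\mathbf{Cat}$.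
   Context: A quantale $\mathsf V=(\mathsf V,\otimes,\mathsf k)$ is a complete lattice with a (not necessarily commutative) monoid structure whose operation $\otimes$ preserves arbitrary suprema in each variable; it is completely distributive if its underlying lattice is, and integral if $\mathsf k=\top$. A lax homomorphism $\psi:(\mathsf W,\otimes,\mathsf l)\to(\mathsf V,\otimes,\mathsf k)$ is a monotone map with $\mathsf k\le\psi(\mathsf l)$ and $\psi(u)\otimes\psi(w)\le\psi(u\otimes w)$ for all $u,w\in\mathsf W$. $\mathsf V\text{-}\mathbf{Cat}$: objects are sets $X$ with $a:X\times X\to\mathsf V$ such that $\mathsf k\le a(x,x)$ and $a(x,y)\otimes a(y,z)\le a(x,z)$ for all $x,y,z$; morphisms $f:(X,a)\to(Y,b)$ are maps with $a(x,y)\le b(f(x),f(y))$. $(\beta,\mathsf V)\text{-}\mathbf{Alg}$: $\mathsf UX$ is the set of ultrafilters on $X$; $\dot x$ is the principal ultrafilter at $x$; $f[\mathfrak x]=\{B: f^{-1}B\in\mathfrak x\}$; $A\in\Sigma_X\mathfrak X\iff\{\mathfrak x\in\mathsf UX: A\in\mathfrak x\}\in\mathfrak X$ for $\mathfrak X\in\mathsf U\mathsf UX$. Objects are sets $X$ with a map $\ell:\mathsf UX\to\mathsf V^X$ such that $\mathsf k\le\ell(\dot x)(x)$ and $\big(\bigwedge_{\mathcal A\in\mathfrak X,\,B\in\mathfrak y}\bigvee_{\mathfrak x\in\mathcal A,\,y\in B}(\ell\mathfrak x)(y)\big)\otimes(\ell\mathfrak y)(z)\le\ell(\Sigma_X\mathfrak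 X)(z)$ for all $x,z\in X$, $\mathfrak X\in\mathsf U\mathsf UX$, $\mathfrak y\in\mathsf UX$; morphisms $f:(X,\ell)\to(Y,\ell')$ are maps with $(\ell\mathfrak x)(y)\le(\ell'f[\mathfrak x])(f(y))$. All functors below are identical on underlying maps. $B_\psi$ sends a structure $\ell$ to $(\mathfrak x,y)\mapsto\psi((\ell\mathfrak x)(y))$ in case (ii), and a structure $b$ to $\psi\cdot b$ in case (iii). $\overline B_\varphi$ sends $(X,\ell)$ to $X$ equipped with the least $(\beta,\mathsf W)$-algebra structure $\ell'$ (pointwise order) satisfying $\varphi((\ell\mathfrak x)(y))\le(\ell'\mathfrak x)(y)$ for all $\mathfrak x\in\mathsf UX$, $y\in X$ in case (ii), and sends $(X,a)$ to $X$ equipped with the least $\mathsf W$-category structure $b$ satisfying $\varphi\cdot a\le b$ in case (iii); these least structures exist. *)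

(* Defs.v *)
From HB Require Import structures.
From mathcomp Require Import all_boot all_order.
From mathcomp Require Import boolp classical_sets functions filter.

Set Implicit Arguments.
Unset Strict Implicit.
Unset Printing Implicit Defensive.

Import Order.TTheory.
Local Open Scope order_scope.
Local Open Scope classical_set_scope.

HB.mixin Record isComplete d T of Order.TBLattice d T := {
  supremums_neq0 : forall A : set T, supremums A !=set0
}.

#[short(type="completeLatticeType")]
HB.structure Definition CompleteLattice d :=
  {T of Order.TBLattice d T & isComplete d T}.

(* The default values make both operations correct on the empty set. *)
Definition lub {d} {T : completeLatticeType d} (A : set T) : T :=
  supremum \bot A.
Definition glb {d} {T : completeLatticeType d} (A : set T) : T :=
  infimum \top A.

HB.mixin Record isQuantale d T of CompleteLattice d T & monoid.Monoid T := {
  mulg_lubr : forall (u : T) (A : set T),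
    (u * lub A)%g = lub [set (u * v)%g | v in A];
  mulg_lubl : forall (u : T) (A : set T),
    (lub A * u)%g = lub [set (v * u)%g | v in A]
}.

#[short(type="quantaleType")]
HB.structure Definition Quantale d :=
  {T of CompleteLattice d T & monoid.Monoid T & isQuantale d T}.

Definition completely_distributive d (T : completeLatticeType d) : Prop :=
  forall (I : Type) (J : I -> Type) (x : forall i, J i -> T),
    glb (range (fun i => lub (range (x i)))) =
    lub (range (fun f : forall i, J i => glb (range (fun i => x i (f i))))).

Definition integral d (V : quantaleType d) : Prop := 1%g = \top :> V.

Definition monotone d d' (V : porderType d) (W : porderType d') (f : V -> W) :=
  {homo f : u v / u <= v}.

Record lax_hom d d' (W : quantaleType d) (V : quantaleType d')
    (psi : W -> V) : Prop := LaxHom {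
  lax_hom_mono : monotone psi;
  lax_hom1 : 1%g <= psi 1%g;
  lax_homM : forall u w, (psi u * psi w)%g <= psi (u * w)%g
}.

Definition left_adjoint_map d d' (V : porderType d) (W : porderType d')
    (phi : V -> W) (psi : W -> V) : Prop :=
  forall v w, phi v <= w <-> v <= psi w.

Section QuantaleFacts.
Context {d} {T : completeLatticeType d}.
Implicit Types (A B : set T) (u v : T).

Lemma lub_supremums A : supremums A (lub A).
Proof.
rewrite /lub /supremum; case: ifPn => [/eqP ->|_].
  by split=> [u []|u _]; exact: le0x.
have [w Aw] := supremums_neq0 A.
by rewrite (xget_subset1 \bot Aw (@is_subset1_supremums _ _ A)).
Qed.

Lemma lub_ub A u : A u -> u <= lub A.
Proof. exact: (lub_supremums A).1. Qed.

Lemma lub_le A u : (forall v, A v -> v <= u) -> lub A <= u.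
Proof. exact: (lub_supremums A).2. Qed.

Lemma glb_infimums A : infimums A (glb A).
Proof.
rewrite /glb /infimum; case: ifPn => [/eqP ->|_].
  by split=> [u []|u _]; exact: lex1.
have Aw : infimums A (lub (lbound A)).
  split=> [v Av|v Av]; last exact: lub_ub.
  by apply: lub_le => w; exact.
by rewrite (xget_subset1 \top Aw (@is_subset1_infimums _ _ A)).
Qed.

Lemma glb_lb A u : A u -> glb A <= u.
Proof. exact: (glb_infimums A).1. Qed.

Lemma le_glb A u : (forall v, A v -> u <= v) -> u <= glb A.
Proof. exact: (glb_infimums A).2. Qed.

End QuantaleFacts.

Lemma mulg_le d (V : quantaleType d) (u u' v v' : V) :
  u <= u' -> v <= v' -> (u * v)%g <= (u' * v')%g.
Proof.
have lubE (x y : V) : x <= y -> lub [set x; y] = y.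
  move=> xy; apply/eqP; rewrite eq_le; apply/andP; split.
    by apply: lub_le => z [] ->.
  by apply: lub_ub; right.
move=> uu' vv'; apply: (@le_trans _ _ (u' * v)%g).
  rewrite -(lubE _ _ uu') mulg_lubl; apply: lub_ub.
  by exists u => //; left.
rewrite -(lubE _ _ vv') mulg_lubr; apply: lub_ub.
by exists v => //; left.
Qed.

Record category := Category {
  obj :> Type;
  hom : obj -> obj -> Type;
  idm : forall X, hom X X;
  comp : forall X Y Z, hom Y Z -> hom X Y -> hom X Z;
  comp1m : forall X Y (f : hom X Y), comp (idm Y) f = f;
  compm1 : forall X Y (f : hom X Y), comp f (idm X) = f;
  compmA : forall X Y Z T (h : hom Z T) (g : hom Y Z) (f : hom X Y),
    comp h (comp g f) = comp (comp h g) f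
}.

Record functor (C D : category) := Functor {
  fobj :> C -> D;
  fmor : forall X Y, hom X Y -> hom (fobj X) (fobj Y);
  fmor1 : forall X, fmor (idm X) = idm (fobj X);
  fmorM : forall X Y Z (g : hom Y Z) (f : hom X Y),
    fmor (comp g f) = comp (fmor g) (fmor f)
}.

Definition adjoint (C D : category) (F : functor C D) (G : functor D C) : Prop :=
  exists Phi : forall (X : C) (Y : D), hom (F X) Y -> hom X (G Y),
    (forall X Y, bijective (Phi X Y)) /\
    (forall X X' Y Y' (f : hom X' X) (h : hom (F X) Y) (g : hom Y Y'),
       Phi X' Y' (comp g (comp h (fmor F f))) =
       comp (fmor G g) (comp (Phi X Y h) f)).

Lemma sig_eq T (P : T -> Prop) (x y : {t | P t}) : sval x = sval y -> x = y.
Proof. by case: x y => [x Px] [y Py] /= xy; exact: eq_exist. Qed.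

Section VCat.
Context {d} (V : quantaleType d).

Definition is_vcat (X : Type) (a : X -> X -> V) : Prop :=
  (forall x, 1%g <= a x x) /\
  (forall x y z, (a x y * a y z)%g <= a x z).

Record vcat := VCatObj {
  vcat_sort :> Type;
  vcat_str : vcat_sort -> vcat_sort -> V;
  vcat_ax : is_vcat vcat_str
}.

Definition is_vfunctor (X Y : vcat) (f : X -> Y) : Prop :=
  forall x y, vcat_str x y <= vcat_str (f x) (f y).

Definition vcat_hom (X Y : vcat) := {f : X -> Y | is_vfunctor f}.

Lemma vcat_id_subproof (X : vcat) : is_vfunctor (idfun : X -> X).
Proof. by move=> x y; exact: lexx. Qed.

Definition vcat_id (X : vcat) : vcat_hom X X :=
  exist _ idfun (@vcat_id_subproof X).

Lemma vcat_comp_subproof (X Y Z : vcat) (g : vcat_hom Y Z) (f : vcat_hom X Y) :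
  is_vfunctor (sval g \o sval f).
Proof. by move=> x y; apply: (le_trans (svalP f x y)); exact: (svalP g). Qed.

Definition vcat_comp (X Y Z : vcat) (g : vcat_hom Y Z) (f : vcat_hom X Y) :
  vcat_hom X Z := exist _ (sval g \o sval f) (vcat_comp_subproof g f).

Definition VCat : category.
Proof.
by apply: (@Category vcat vcat_hom vcat_id vcat_comp) => *; apply: sig_eq.
Defined.

End VCat.

Record ultrafilter (X : Type) := Ultrafilter {
  uf_sets :> set_system X;
  uf_ultra : UltraFilter uf_sets
}.

Lemma ultrafilter_eq X (F G : ultrafilter X) :
  uf_sets F = uf_sets G -> F = G.
Proof.
case: F G => [F uF] [G uG] /= FG; case: _ / FG in uG *.
by rewrite (Prop_irrelevance uF uG).
Qed.

Lemma ultra_setVsetC X (F : set_system X) :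
  ProperFilter F -> (forall A, F A \/ F (~` A)) -> UltraFilter F.
Proof.
move=> PF FA; split=> // G PG FG; rewrite eqEsubset; split=> // A GA.
have [//|FcA] := FA A.
have : G (A `&` ~` A) by apply: filterI => //; exact: FG.
by rewrite setICr => /(@filter_not_empty _ _ PG).
Qed.

Definition principal_uf X (x : X) : ultrafilter X :=
  Ultrafilter (principal_filter_ultra x).

Lemma push_ultra X Y (f : X -> Y) (F : ultrafilter X) :
  UltraFilter (fmap f F).
Proof.
have uF := uf_ultra F; have pF := @ultra_proper _ _ uF.
apply: (@ultra_setVsetC _ _ (fmap_proper_filter f pF)).
by move=> A; exact: (in_ultra_setVsetC (f @^-1` A) uF).
Qed.

Definition push X Y (f : X -> Y) (F : ultrafilter X) : ultrafilter Y :=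
  Ultrafilter (push_ultra f F).

(* The Kowalski sum [Sigma_X]. *)
Definition ksum_sets X (FF : ultrafilter (ultrafilter X)) : set_system X :=
  [set A | uf_sets FF [set F | uf_sets F A]].

Lemma ksum_ultra X (FF : ultrafilter (ultrafilter X)) :
  UltraFilter (ksum_sets FF).
Proof.
have uFF := uf_ultra FF; have pFF := @ultra_proper _ _ uFF.
have uP (F : ultrafilter X) : ProperFilter F.
  exact: (@ultra_proper _ _ (uf_ultra F)).
have pS : ProperFilter (ksum_sets FF).
  split; rewrite /ksum_sets /=.
    move=> F0; apply: (@filter_not_empty _ _ pFF).
    by apply: filterS F0 => F /= /(@filter_not_empty _ _ (uP F)).
  split.
  - by apply: (@filterS _ FF _ setT) => [F _|]; exact: filterT.
  - move=> A B FA FB.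
    have FAB : uf_sets FF ([set F | uf_sets F A] `&` [set F | uf_sets F B]).
      by apply: (@filterI _ FF).
    by apply: (@filterS _ FF) FAB => F []; exact: filterI.
  - by move=> A B AB; apply: (@filterS _ FF) => F; exact: filterS.
apply: ultra_setVsetC => A.
have [|FcA] := in_ultra_setVsetC [set F : ultrafilter X | uf_sets F A] uFF.
  by left.
right; apply: filterS FcA => F /= nFA.
by have [//|] := in_ultra_setVsetC A (uf_ultra F).
Qed.

Definition ksum X (FF : ultrafilter (ultrafilter X)) : ultrafilter X :=
  Ultrafilter (ksum_ultra FF).

Section BetaAlg.
Context {d} (V : quantaleType d).

(* The extension of [l] to a relation from UUX to UX. *)
Definition uf_ext (X : Type) (l : ultrafilter X -> X -> V)
    (FF : ultrafilter (ultrafilter X)) (G : ultrafilter X) : V :=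
  glb [set lub [set l F y | F in A & y in B] |
        A in uf_sets FF & B in uf_sets G].

Definition is_beta_alg (X : Type) (l : ultrafilter X -> X -> V) : Prop :=
  (forall x, 1%g <= l (principal_uf x) x) /\
  (forall (FF : ultrafilter (ultrafilter X)) (G : ultrafilter X) (z : X),
     (uf_ext l FF G * l G z)%g <= l (ksum FF) z).

Record beta_alg := BetaAlgObj {
  beta_sort :> Type;
  beta_str : ultrafilter beta_sort -> beta_sort -> V;
  beta_ax : is_beta_alg beta_str
}.

Definition is_beta_hom (X Y : beta_alg) (f : X -> Y) : Prop :=
  forall (F : ultrafilter X) (y : X),
    beta_str F y <= beta_str (push f F) (f y).

Definition beta_hom (X Y : beta_alg) := {f : X -> Y | is_beta_hom f}.

Lemma beta_id_subproof (X : beta_alg) : is_beta_hom (idfun : X -> X).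
Proof. by move=> F y; rewrite (_ : push idfun F = F) //; exact: ultrafilter_eq. Qed.

Definition beta_id (X : beta_alg) : beta_hom X X :=
  exist _ idfun (@beta_id_subproof X).

Lemma beta_comp_subproof (X Y Z : beta_alg)
  (g : beta_hom Y Z) (f : beta_hom X Y) : is_beta_hom (sval g \o sval f).
Proof.
move=> F y; apply: (le_trans (svalP f F y)).
apply: (le_trans (svalP g _ _)).
by rewrite (_ : push _ (push _ F) = push (sval g \o sval f) F) //;
  exact: ultrafilter_eq.
Qed.

Definition beta_comp (X Y Z : beta_alg) (g : beta_hom Y Z) (f : beta_hom X Y) :
  beta_hom X Z := exist _ (sval g \o sval f) (beta_comp_subproof g f).

Definition BetaAlg : category.
Proof.
by apply: (@Category beta_alg beta_hom beta_id beta_comp) => *; apply: sig_eq.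
Defined.

Lemma uf_ext_mono X (l l' : ultrafilter X -> X -> V) FF G :
  (forall F y, l F y <= l' F y) -> uf_ext l FF G <= uf_ext l' FF G.
Proof.
move=> ll'; apply: le_glb => _ [A FA [B GB <-]].
apply: (@le_trans _ _ (lub [set l F y | F in A & y in B])).
  by apply: glb_lb; exists A => //; exists B.
apply: lub_le => _ [F AF [y By <-]]; apply: (le_trans (ll' F y)).
by apply: lub_ub; exists F => //; exists y.
Qed.

Lemma is_beta_alg_pullback (X Y : Type) (f : X -> Y)
    (l : ultrafilter Y -> Y -> V) :
  is_beta_alg l -> is_beta_alg (fun F x => l (push f F) (f x)).
Proof.
move=> [l1 lM]; split=> [x|FF G z].
  rewrite (_ : push f _ = principal_uf (f x)) //; apply: ultrafilter_eq.
  by apply/seteqP; split=> A /= /principal_filterP fA; exact/principal_filterP.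
rewrite (_ : push f (ksum FF) = ksum (push (push f) FF)); last first.
  exact: ultrafilter_eq.
apply: le_trans (lM _ (push f G) _); apply: mulg_le => //.
apply: le_glb => _ [A FA [B GB <-]].
apply: (@le_trans _ _ (lub [set l (push f F) (f y) |
  F in push f @^-1` A & y in f @^-1` B])).
  by apply: glb_lb; exists (push f @^-1` A) => //; exists (f @^-1` B).
apply: lub_le => _ [F AF [y By <-]].
by apply: lub_ub; exists (push f F) => //; exists (f y).
Qed.

End BetaAlg.

Section ChangeOfBase.
Context {dV dW} {V : quantaleType dV} {W : quantaleType dW}.
Implicit Types (phi : V -> W) (psi : W -> V).

Section Cat.

Lemma B_cat_subproof (psi : W -> V) (hpsi : lax_hom psi) (X : vcat W) :
  is_vcat (fun x y : X => psi (vcat_str x y)).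
Proof.
case: hpsi => psim psi1 psiM; have [a1 aM] := vcat_ax X; split=> [x|x y z].
  exact/(le_trans psi1)/psim/a1.
exact/(le_trans (psiM _ _))/psim/aM.
Qed.

Definition B_cat_obj psi (hpsi : lax_hom psi) (X : vcat W) : vcat V :=
  VCatObj (B_cat_subproof hpsi X).

Lemma B_cat_mor_subproof psi (hpsi : lax_hom psi) (X Y : vcat W)
  (f : vcat_hom X Y) :
  @is_vfunctor _ _ (B_cat_obj hpsi X) (B_cat_obj hpsi Y) (sval f).
Proof. by move=> x y; apply: (lax_hom_mono hpsi); exact: svalP f x y. Qed.

Definition B_cat_mor psi (hpsi : lax_hom psi) (X Y : vcat W)
    (f : vcat_hom X Y) : vcat_hom (B_cat_obj hpsi X) (B_cat_obj hpsi Y) :=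
  exist _ (sval f) (@B_cat_mor_subproof _ hpsi X Y f).

Definition B_cat psi (hpsi : lax_hom psi) : functor (VCat W) (VCat V).
Proof.
by apply: (@Functor (VCat W) (VCat V) (B_cat_obj hpsi)
  (@B_cat_mor _ hpsi)) => *; apply: sig_eq.
Defined.

Definition dominates_cat (phi : V -> W) X (a : X -> X -> V) (b : X -> X -> W) :=
  forall x y, phi (a x y) <= b x y.

Definition least_cat_str (phi : V -> W) X (a : X -> X -> V) : X -> X -> W :=
  fun x y => glb [set b x y | b in
    [set b : X -> X -> W | is_vcat b /\ dominates_cat phi a b]].

Lemma least_cat_str_ax phi X (a : X -> X -> V) : is_vcat (least_cat_str phi a).
Proof.
split=> [x|x y z]; apply: le_glb => _ [b [[b1 bM] ab] <-]; first exact: b1.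
apply: le_trans (bM x y z).
by apply: mulg_le; apply: glb_lb; exists b.
Qed.

Lemma least_cat_str_dominates phi X (a : X -> X -> V) :
  dominates_cat phi a (least_cat_str phi a).
Proof. by move=> x y; apply: le_glb => _ [b [_ ab] <-]; exact: ab. Qed.

Lemma least_cat_str_min phi X (a : X -> X -> V) (b : X -> X -> W) :
  is_vcat b -> dominates_cat phi a b ->
  forall x y, least_cat_str phi a x y <= b x y.
Proof. by move=> bP ab x y; apply: glb_lb; exists b. Qed.

Definition Bbar_cat_obj phi (X : vcat V) : vcat W :=
  VCatObj (least_cat_str_ax phi (@vcat_str _ _ X)).

Lemma Bbar_cat_mor_subproof phi (hphi : monotone phi) (X Y : vcat V)
  (f : vcat_hom X Y) :
  @is_vfunctor _ _ (Bbar_cat_obj phi X) (Bbar_cat_obj phi Y) (sval f).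
Proof.
have [c1 cM] := vcat_ax (Bbar_cat_obj phi Y).
apply: (@least_cat_str_min phi X (@vcat_str _ _ X) (fun x y =>
  @vcat_str _ _ (Bbar_cat_obj phi Y) (sval f x) (sval f y))) => [|x y].
  by split=> *; [exact: c1|exact: cM].
exact: le_trans (hphi _ _ (svalP f x y)) (least_cat_str_dominates _ _ _ _).
Qed.

Definition Bbar_cat_mor phi (hphi : monotone phi) (X Y : vcat V)
    (f : vcat_hom X Y) : vcat_hom (Bbar_cat_obj phi X) (Bbar_cat_obj phi Y) :=
  exist _ (sval f) (@Bbar_cat_mor_subproof _ hphi X Y f).

Definition Bbar_cat phi (hphi : monotone phi) : functor (VCat V) (VCat W).
Proof.
by apply: (@Functor (VCat V) (VCat W) (Bbar_cat_obj phi)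
  (@Bbar_cat_mor _ hphi)) => *; apply: sig_eq.
Defined.

End Cat.

Section Beta.

(* Unlike for V-categories, this may fail for a lax homomorphism, as [psi]
   need not preserve the infima in [uf_ext]. *)
Definition B_beta_preserves (psi : W -> V) : Prop :=
  forall X : beta_alg W, is_beta_alg (fun F (y : X) => psi (beta_str F y)).

Definition B_beta_obj psi (H : B_beta_preserves psi) (X : beta_alg W) :
  beta_alg V := BetaAlgObj (H X).

Lemma B_beta_mor_subproof psi (hpsi : lax_hom psi) (H : B_beta_preserves psi)
  (X Y : beta_alg W) (f : beta_hom X Y) :
  @is_beta_hom _ _ (B_beta_obj H X) (B_beta_obj H Y) (sval f).
Proof. by move=> F y; apply: (lax_hom_mono hpsi); exact: svalP f F y. Qed.

Definition B_beta_mor psi (hpsi : lax_hom psi) (H : B_beta_preserves psi) (X Y : beta_alg W)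
    (f : beta_hom X Y) : beta_hom (B_beta_obj H X) (B_beta_obj H Y) :=
  exist _ (sval f) (@B_beta_mor_subproof _ hpsi H X Y f).

Definition B_beta psi (hpsi : lax_hom psi) (H : B_beta_preserves psi) :
  functor (BetaAlg W) (BetaAlg V).
Proof.
by apply: (@Functor (BetaAlg W) (BetaAlg V) (B_beta_obj H)
  (@B_beta_mor _ hpsi H)) => *; apply: sig_eq.
Defined.

Definition dominates_beta (phi : V -> W) X (l : ultrafilter X -> X -> V)
    (l' : ultrafilter X -> X -> W) :=
  forall F y, phi (l F y) <= l' F y.

Definition least_beta_str (phi : V -> W) X (l : ultrafilter X -> X -> V) :
    ultrafilter X -> X -> W :=
  fun F y => glb [set l' F y | l' in
    [set l' : ultrafilter X -> X -> W |
      is_beta_alg l' /\ dominates_beta phi l l']].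

Lemma least_beta_str_min phi X (l : ultrafilter X -> X -> V)
    (l' : ultrafilter X -> X -> W) :
  is_beta_alg l' -> dominates_beta phi l l' ->
  forall F y, least_beta_str phi l F y <= l' F y.
Proof. by move=> lP ll' F y; apply: glb_lb; exists l'. Qed.

Lemma least_beta_str_ax phi X (l : ultrafilter X -> X -> V) :
  is_beta_alg (least_beta_str phi l).
Proof.
split=> [x|FF G z]; apply: le_glb => _ [l' [l'P ll'] <-]; first exact: l'P.1.
apply: le_trans (l'P.2 FF G z).
by apply: mulg_le; [apply: uf_ext_mono|]; move=> *; exact: least_beta_str_min.
Qed.

Lemma least_beta_str_dominates phi X (l : ultrafilter X -> X -> V) :
  dominates_beta phi l (least_beta_str phi l).
Proof. by move=> F y; apply: le_glb => _ [l' [_ ll'] <-]; exact: ll'. Qed.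

Definition Bbar_beta_obj phi (X : beta_alg V) : beta_alg W :=
  BetaAlgObj (least_beta_str_ax phi (@beta_str _ _ X)).

Lemma Bbar_beta_mor_subproof phi (hphi : monotone phi) (X Y : beta_alg V)
  (f : beta_hom X Y) :
  @is_beta_hom _ _ (Bbar_beta_obj phi X) (Bbar_beta_obj phi Y) (sval f).
Proof.
apply: (@least_beta_str_min phi X (@beta_str _ _ X) (fun F y =>
  @beta_str _ _ (Bbar_beta_obj phi Y) (push (sval f) F) (sval f y))) => [|F y].
  exact: is_beta_alg_pullback (beta_ax (Bbar_beta_obj phi Y)).
exact: le_trans (hphi _ _ (svalP f F y)) (least_beta_str_dominates _ _ _ _).
Qed.

Definition Bbar_beta_mor phi (hphi : monotone phi) (X Y : beta_alg V)
    (f : beta_hom X Y) : beta_hom (Bbar_beta_obj phi X) (Bbar_beta_obj phi Y) :=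
  exist _ (sval f) (@Bbar_beta_mor_subproof _ hphi X Y f).

Definition Bbar_beta phi (hphi : monotone phi) :
  functor (BetaAlg V) (BetaAlg W).
Proof.
by apply: (@Functor (BetaAlg V) (BetaAlg W) (Bbar_beta_obj phi)
  (@Bbar_beta_mor _ hphi)) => *; apply: sig_eq.
Defined.

End Beta.

End ChangeOfBase.

(* Main.v *)
Require Import Defs.
From mathcomp Require Import all_boot all_order.
From mathcomp Require Import boolp classical_sets filter.

(** The functors are identical on underlying maps, and the structure of
    [Bbar_phi X] is the least one above the image of that of [X] under [phi],
    so [phi -| psi] says exactly that a map is a morphism [Bbar_phi X -> Y] iff
    it is a morphism [X -> B_psi Y]; for algebras, [psi] preserves infima as a
    right adjoint, which makes [B_psi] well defined.

    Conversely, a natural bijection [hom (Bbar X) Y -> hom X (B Y)] does not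
    change underlying maps: evaluation at a point is precomposition with a
    morphism from the one-point object, and naturality reduces that case to an
    endomap of a point.  Applying this to the identity of a two-point object
    whose only nontrivial value is [v], resp. [w], gives
    [phi v <= w <-> v <= psi w]. *)

Set Implicit Arguments.
Unset Strict Implicit.
Unset Printing Implicit Defensive.

Import Order.TTheory.
Local Open Scope order_scope.
Local Open Scope classical_set_scope.

(** * Integral quantales, and ultrafilters on a point *)

Section IntegralQuantale.
Context {d : Order.disp_t} {V : quantaleType d}.
Hypothesis hV : integral V.

Lemma le1_integral (u : V) : u <= 1%g.
Proof. by rewrite hV lex1. Qed.

Lemma mulg_ler (u v : V) : (u * v)%g <= v.
Proof. by rewrite -{2}[v]mul1g; apply: mulg_le => //; exact: le1_integral. Qed.

End IntegralQuantale.

Lemma uf_set1 (X : Type) (F : ultrafilter X) (x : X) :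
  uf_sets F [set x] -> F = principal_uf x.
Proof.
move=> Fx; have pF := @ultra_proper _ _ (uf_ultra F).
apply: ultrafilter_eq; apply/seteqP; split=> A /=.
  move=> FA; apply/principal_filterP.
  have : uf_sets F ([set x] `&` A) by exact: filterI.
  by move=> /(@filter_ex _ _ pF)[_ [-> Ax]].
by move=> /principal_filterP Ax; apply: filterS Fx => _ ->.
Qed.

Lemma push_unit (X : Type) (f : unit -> X) (F : ultrafilter unit) :
  push f F = principal_uf (f tt).
Proof.
have pF := @ultra_proper _ _ (uf_ultra F).
by apply: uf_set1; apply: (@filterS _ F _ setT) => [[]|]//; exact: filterT.
Qed.

Lemma push_id (X : Type) (F : ultrafilter X) : push id F = F.
Proof. exact: ultrafilter_eq. Qed.

(** * Test objects: the point and the two-point arrows *)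

Section TestObjects.
Context {d : Order.disp_t} {V : quantaleType d}.
Hypothesis hV : integral V.

Lemma point_cat_subproof : is_vcat (fun _ _ : unit => 1%g : V).
Proof. by split=> *; rewrite ?mulg1. Qed.

Definition point_cat : vcat V := VCatObj point_cat_subproof.

Definition arrow_cat_str (v : V) (x y : bool) : V :=
  if ~~ x && y then v else 1%g.

(** A triangle inequality either has the top value [1] on its right, or runs from [false] to [true];
    then its two factors are [v] and [1] in some order. *)
Lemma arrow_cat_subproof v : is_vcat (arrow_cat_str v).
Proof.
rewrite /arrow_cat_str; split=> [[]//|[] [] []] /=;
  by rewrite ?mulg1 ?mul1g //; exact: le1_integral.
Qed.

Definition arrow_cat v : vcat V := VCatObj (arrow_cat_subproof v).

Lemma point_cat_hom_subproof (X : vcat V) (x : X) :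
  @is_vfunctor _ _ point_cat X (fun=> x).
Proof. by move=> ? ?; exact: (vcat_ax X).1. Qed.

Definition point_cat_hom (X : vcat V) (x : X) : vcat_hom point_cat X :=
  exist _ (fun=> x) (point_cat_hom_subproof x).

Lemma point_beta_subproof :
  is_beta_alg (fun (_ : ultrafilter unit) (_ : unit) => 1%g : V).
Proof. by split=> * //; exact: le1_integral. Qed.

Definition point_beta : beta_alg V := BetaAlgObj point_beta_subproof.

(** By [uf_set1] the condition on [F] says that [F] is principal at [false], so this is
    [arrow_cat_str v] carried over to ultrafilters. *)
Definition arrow_beta_str (v : V) (F : ultrafilter bool) (y : bool) : V :=
  if y && `[< uf_sets F [set false] >] then v else 1%g.

Lemma arrow_beta_subproof v : is_beta_alg (arrow_beta_str v).
Proof.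
split=> [[]|FF G []]; rewrite /arrow_beta_str /=; last exact: (le1_integral hV).
- by case: asboolP => // /principal_filterP.
- by [].
case: (asboolP (ksum_sets _ _)) => [FFfalse|_]; last exact: le1_integral.
case: asboolP => [_|NGfalse]; first exact: mulg_ler.
rewrite mulg1.
(* Here [G] lives on [true], so the infimum itself must be at most [v]. The ultrafilters containing
   [[set false]] form a member of [FF], by definition of the Kowalski sum, and against [true] they
   all take the value [v]. *)
have [//|Gtrue] := in_ultra_setVsetC [set false] (uf_ultra G).
apply: (@le_trans _ _ (lub [set arrow_beta_str v F y |
    F in [set F | uf_sets F [set false]] & y in ~` [set false]])).
  apply: glb_lb; exists [set F | uf_sets F [set false]] => //.
  by exists (~` [set false]).
apply: lub_le => _ [F Ffalse [y yN <-]]; rewrite /arrow_beta_str.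
by case: y yN => //= _; case: asboolP.
Qed.

Definition arrow_beta v : beta_alg V := BetaAlgObj (arrow_beta_subproof v).

Lemma point_beta_hom_subproof (X : beta_alg V) (x : X) :
  @is_beta_hom _ _ point_beta X (fun=> x).
Proof. by move=> F y; rewrite push_unit; exact: (beta_ax X).1. Qed.

Definition point_beta_hom (X : beta_alg V) (x : X) : beta_hom point_beta X :=
  exist _ (fun=> x) (point_beta_hom_subproof x).

End TestObjects.

(** * From the adjoint maps to the adjoint functors *)

Section Adjunction.
Context {dV dW : Order.disp_t} {V : quantaleType dV} {W : quantaleType dW}.
Variables (phi : V -> W) (hphi : monotone phi).
Variables (psi : W -> V) (hpsi : lax_hom psi).

Lemma left_adjoint_glb : left_adjoint_map phi psi ->
  forall A : set W, glb (psi @` A) <= psi (glb A).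
Proof.
move=> adj A; apply/adj; apply: le_glb => w Aw; apply/adj.
by apply: glb_lb; exists w.
Qed.

Lemma left_adjoint_B_beta_preserves :
  left_adjoint_map phi psi -> B_beta_preserves psi.
Proof.
move=> adj X; have [l1 lM] := beta_ax X; split=> [x|FF G z].
  exact: le_trans (lax_hom1 hpsi) (lax_hom_mono hpsi (l1 x)).
apply: le_trans (lax_hom_mono hpsi (lM FF G z)).
apply: le_trans (lax_homM hpsi _ _); apply: mulg_le => //.
(* The adjunction pulls [psi] out of the infimum; for the inner suprema monotonicity suffices, as it
   gives the inequality in the direction required. *)
apply: le_trans (left_adjoint_glb adj _).
apply: le_glb => _ [_ [A FA [B GB <-]] <-].
apply: (@le_trans _ _ (lub [set psi (beta_str F y) | F in A & y in B])).
  by apply: glb_lb; exists A => //; exists B.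
apply: lub_le => _ [F AF [y By <-]]; apply: (lax_hom_mono hpsi).
by apply: lub_ub; exists F => //; exists y.
Qed.

(** The structure of [Y] pulled back along [f] is again a category structure, so leastness can be
    tested against it. *)
Lemma Bbar_cat_homP (X : vcat V) (Y : vcat W) (f : X -> Y) :
  @is_vfunctor _ _ (Bbar_cat_obj phi X) Y f <->
  forall x y : X, phi (vcat_str x y) <= vcat_str (f x) (f y).
Proof.
split=> [hf x y|hf].
  exact: le_trans (least_cat_str_dominates _ _ _ _) (hf x y).
have [c1 cM] := vcat_ax Y.
by apply: (@least_cat_str_min _ _ _ _ phi X (@vcat_str _ _ X)
  (fun x y => vcat_str (f x) (f y))).
Qed.

Lemma Bbar_beta_homP (X : beta_alg V) (Y : beta_alg W) (f : X -> Y) :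
  @is_beta_hom _ _ (Bbar_beta_obj phi X) Y f <->
  forall (F : ultrafilter X) (y : X),
    phi (beta_str F y) <= beta_str (push f F) (f y).
Proof.
split=> [hf F y|hf].
  exact: le_trans (least_beta_str_dominates _ _ _ _) (hf F y).
apply: (@least_beta_str_min _ _ _ _ phi X (@beta_str _ _ X)
  (fun F y => beta_str (push f F) (f y))) => //.
exact: is_beta_alg_pullback (beta_ax Y).
Qed.

Lemma left_adjoint_cat :
  left_adjoint_map phi psi -> adjoint (Bbar_cat hphi) (B_cat hpsi).
Proof.
move=> adj.
have homP (X : vcat V) (Y : vcat W) (f : X -> Y) :
    @is_vfunctor _ _ (Bbar_cat_obj phi X) Y f <->
    @is_vfunctor _ _ X (B_cat_obj hpsi Y) f.
  by rewrite Bbar_cat_homP; split=> hf x y; apply/adj; exact: hf.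
exists (fun X Y h => exist _ (sval h) ((homP X Y (sval h)).1 (svalP h))).
split=> [X Y|X X' Y Y' f h g]; last exact: sig_eq.
by exists (fun h => exist _ (sval h) ((homP X Y (sval h)).2 (svalP h))) => h;
  exact: sig_eq.
Qed.

Lemma left_adjoint_beta (H : B_beta_preserves psi) :
  left_adjoint_map phi psi -> adjoint (Bbar_beta hphi) (B_beta hpsi H).
Proof.
move=> adj.
have homP (X : beta_alg V) (Y : beta_alg W) (f : X -> Y) :
    @is_beta_hom _ _ (Bbar_beta_obj phi X) Y f <->
    @is_beta_hom _ _ X (B_beta_obj H Y) f.
  by rewrite Bbar_beta_homP; split=> hf F y; apply/adj; exact: hf.
exists (fun X Y h => exist _ (sval h) ((homP X Y (sval h)).1 (svalP h))).
split=> [X Y|X X' Y Y' f h g]; last exact: sig_eq.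
by exists (fun h => exist _ (sval h) ((homP X Y (sval h)).2 (svalP h))) => h;
  exact: sig_eq.
Qed.

(** * From the adjoint functors back to the adjoint maps *)

Hypotheses (hV : integral V) (hW : integral W).

Lemma adjoint_cat_homP (X : vcat V) (Y : vcat W) (f : X -> Y) :
  adjoint (Bbar_cat hphi) (B_cat hpsi) ->
  @is_vfunctor _ _ (Bbar_cat_obj phi X) Y f <->
  @is_vfunctor _ _ X (B_cat_obj hpsi Y) f.
Proof.
move=> [Phi [Phi_bij Phi_nat]].
pose E : VCat V := @point_cat _ V.
pose FE : VCat W := Bbar_cat hphi E.
have PhiE (Z : VCat W) (h : hom FE Z) (t : unit) :
    sval (Phi E Z h) t = sval h tt.
  (* Naturality writes [Phi E Z h] as [h] after the transpose of the identity of [FE], which is an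
     endomap of [unit]. *)
  have := Phi_nat E E FE Z (idm E) (idm FE) h.
  rewrite (_ : Defs.comp h _ = h); last exact: sig_eq.
  move=> /(congr1 (fun k : vcat_hom E _ => sval k t)) /= ->.
  by case: (sval (Phi E FE _) t).
have PhiX (h : hom (Bbar_cat hphi X) Y) : sval (Phi X Y h) = sval h.
  apply/funext => x.
  have := Phi_nat X E Y Y (point_cat_hom x) h (@idm (VCat W) Y).
  by move=> /(congr1 (fun k : vcat_hom E _ => sval k tt)) /=; rewrite PhiE.
split=> hf; first by have := svalP (Phi X Y (exist _ f hf)); rewrite PhiX.
(* Surjectivity of [Phi] gives the converse: [f] is the transpose of some morphism, which by [PhiX]
   has [f] itself as underlying map. *)
have [Psi _ PsiK] := Phi_bij X Y.
have := svalP (Psi (exist _ f hf)); rewrite -PhiX.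
by rewrite PsiK.
Qed.

Lemma adjoint_beta_homP (H : B_beta_preserves psi)
    (X : beta_alg V) (Y : beta_alg W) (f : X -> Y) :
  adjoint (Bbar_beta hphi) (B_beta hpsi H) ->
  @is_beta_hom _ _ (Bbar_beta_obj phi X) Y f <->
  @is_beta_hom _ _ X (B_beta_obj H Y) f.
Proof.
move=> [Phi [Phi_bij Phi_nat]].
pose E : BetaAlg V := point_beta hV.
pose FE : BetaAlg W := Bbar_beta hphi E.
have PhiE (Z : BetaAlg W) (h : hom FE Z) (t : unit) :
    sval (Phi E Z h) t = sval h tt.
  have := Phi_nat E E FE Z (idm E) (idm FE) h.
  rewrite (_ : Defs.comp h _ = h); last exact: sig_eq.
  move=> /(congr1 (fun k : beta_hom E _ => sval k t)) /= ->.
  by case: (sval (Phi E FE _) t).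
have PhiX (h : hom (Bbar_beta hphi X) Y) : sval (Phi X Y h) = sval h.
  (* Precomposing with the point [x] reduces the value of [Phi X Y h] at [x] to [PhiE]. *)
  apply/funext => x.
  have := Phi_nat X E Y Y (point_beta_hom hV x) h (@idm (BetaAlg W) Y).
  by move=> /(congr1 (fun k : beta_hom E _ => sval k tt)) /=; rewrite PhiE.
split=> hf; first by have := svalP (Phi X Y (exist _ f hf)); rewrite PhiX.
have [Psi _ PsiK] := Phi_bij X Y.
have := svalP (Psi (exist _ f hf)); rewrite -PhiX.
by rewrite PsiK.
Qed.

Lemma adjoint_cat_left_adjoint :
  adjoint (Bbar_cat hphi) (B_cat hpsi) -> left_adjoint_map phi psi.
Proof.
move=> adj v w.
have := @adjoint_cat_homP (arrow_cat hV v) (arrow_cat hW w) id adj.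
rewrite Bbar_cat_homP => homP; split=> hvw.
  (* Only the pair [(false, true)] carries information: elsewhere the bound is the top value here,
     and [1 <= psi 1] in the converse. *)
  have /homP/(_ false true) // : forall x y : bool,
    phi (arrow_cat_str v x y) <= arrow_cat_str w x y.
  by case=> [] [] //; exact: le1_integral.
apply: (homP.2 _ false true).
by case=> [] [] //; exact: (lax_hom1 hpsi).
Qed.

Lemma adjoint_beta_left_adjoint (H : B_beta_preserves psi) :
  adjoint (Bbar_beta hphi) (B_beta hpsi H) -> left_adjoint_map phi psi.
Proof.
move=> adj v w.
have := @adjoint_beta_homP H (arrow_beta hV v) (arrow_beta hW w) id adj.
rewrite Bbar_beta_homP => homP.
have strE (d : Order.disp_t) (U : quantaleType d) (u : U) :
    arrow_beta_str u (principal_uf false) true = u.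
  rewrite /arrow_beta_str /=; case: asboolP => // [[]].
  exact/principal_filterP.
split=> hvw.
  have := homP.1 _ (principal_uf false) true.
  (* After [push_id] both arrow structures branch on the same condition, leaving [hvw] and a trivial
     case. *)
  rewrite push_id /= !strE; apply=> F y.
  rewrite push_id /= /arrow_beta_str.
  by case: ifP => // _; exact: le1_integral.
have := homP.2 _ (principal_uf false) true.
rewrite push_id /= !strE; apply=> F y.
rewrite push_id /= /arrow_beta_str.
by case: ifP => // _; exact: (lax_hom1 hpsi).
Qed.

End Adjunction.

Theorem theorem4p4 (dV dW : Order.disp_t)
    (V : quantaleType dV) (W : quantaleType dW)
    (hVcd : completely_distributive V) (hVint : integral V)
    (hWcd : completely_distributive W) (hWint : integral W)
    (phi : V -> W) (hphi : monotone phi)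
    (psi : W -> V) (hpsi : lax_hom psi) :
  (left_adjoint_map phi psi <->
     exists H : B_beta_preserves psi, adjoint (Bbar_beta hphi) (B_beta hpsi H))
  /\
  (left_adjoint_map phi psi <->
     adjoint (Bbar_cat hphi) (B_cat hpsi)).
Proof.
split; split.
- move=> adj; exists (left_adjoint_B_beta_preserves hpsi adj).
  exact: left_adjoint_beta.
- by move=> [H]; exact: adjoint_beta_left_adjoint.
- exact: left_adjoint_cat.
- exact: adjoint_cat_left_adjoint.
Qed.
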